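(* Consider the control affine system $\dot x = f(x)+g(x)u$ with $x\in\mathbb{R}^n$, $u\in U\subset\mathbb{R}^m$, and $f:\mathbb{R}^n\to\mathbb{R}^n$, $g:\mathbb{R}^n\to\mathbb{R}^{n\times m}$ locally Lipschitz continuous. Let $\mathcal{C}=\{x\in\mathbb{R}^n : h(x)\ge 0\}$ for a $C^1$ function $h:\mathbb{R}^n\to\mathbb{R}$ that has relative degree 1, and let $\gamma>0$. Let $0=t_0<t_1<t_2<\dots$ with $t_k\to\infty$ be the sampling instants, $\Delta_k=t_{k+1}-t_k$, and $x_k=x(t_k)$. For each $k\in\mathbb{Z}_{\ge 0}$ let $\mathcal{Z}_k=\mathcal{R}([t_k,t_k+\Delta_k],x_k)\times U$, let $z_k^*=({x_k^*}^{\top},{u_k^*}^{\top})^{\top}\in\mathcal{Z}_k$ be a given state-input pair, and let $(P_k^N,I_k)$ be the $N$-th order interval Taylor model around $z_k^*$ on $\mathcal{Z}_k$ of the function $$\Delta\xi(x,u,x_k)=\xi(x,u)-\xi(x_k,u),\qquad \xi(x,u)=L_fh(x)+L_gh(x)u+\gamma h(x),$$ i.e. $\Delta\xi(x,u,x_k)\in P_k^N(z-z_k^* )+I_k$ for all $z=(x^\top,u^\top)^\top\in\mathcal{Z}_k$. Suppose that $$\phi(x_k,\Delta_k)=\underline I_k+\phi_k^*,$$ where $\underline I_k$ is the lower bound of the interval $I_k$ and $\phi_k^*=\min_{z\in\mathcal{Z}_k}P_k^N(z-z_k^* )$, and that the resulting set $$K^s_{\mathrm{zcbf}}(x_k,\Delta_k)=\{u\in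 U : L_fh(x_k)+L_gh(x_k)u+\gamma h(x_k)+\phi(x_k,\Delta_k)\ge 0\}$$ is non-empty. If $h(x(0))\ge 0$, then any input $u(t)=u_k$ for $t\in[t_k,t_k+\Delta_k)$ such that $u_k\in K^s_{\mathrm{zcbf}}(x_k,\Delta_k)$ (for every $k$) renders $h(x(t))\ge 0$ for all $t\ge 0$.
   Context: Lie derivatives: $L_fh(x)=\frac{\partial h}{\partial x}f(x)$, $L_gh(x)=\frac{\partial h}{\partial x}g(x)$. Relative degree is understood in the standard sense of nonlinear control. $x(t;t_0,x_0)$ (or simply $x(t)$) denotes the solution of the system at time $t$ starting from $x_0$ at time $t_0$ under a given input signal $u(\cdot)$; solutions are assumed to exist for all $t\ge t_0$. Reachable tube: $\mathcal{R}([t_k,t_k+\Delta_k],x_k)$ is the set of all states $x(t;t_k,x_k)$ with $t\in[t_k,t_k+\Delta_k]$, over input signals with values in $U$. Interval Taylor model: for a real-valued function $F$ on a set $S$ that is $(N+1)$ times continuously partially differentiable on an open set containing $S$, and a point $z_0\in S$, an $N$-th order interval Taylor model of $F$ around $z_0$ on $S$ is a pair $(P^N,I)$ where $P^N$ is the $N$-th order Taylor polynomial of $F$ around $z_0$ and $I$ is a real interval such that $F(z)\in P^N(z-z_0)+I$ for all $z\in S$. *)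

(* Defs.v *)
From HB Require Import structures.
From mathcomp Require Export all_boot all_order all_algebra.
From mathcomp Require Export all_classical all_reals all_analysis.

Set Implicit Arguments.
Unset Strict Implicit.
Unset Printing Implicit Defensive.

Export Order.TTheory GRing.Theory Num.Theory.
Export numFieldNormedType.Exports.

Local Open Scope classical_set_scope.
Local Open Scope ring_scope.

Section Smoothness.
Context {R : realType} {d : nat}.
Implicit Types (F : 'cV[R]_d -> R) (z : 'cV[R]_d) (s : seq 'I_d).

Definition partial (i : 'I_d) F : 'cV[R]_d -> R := 'D_(delta_mx i 0) F.

Definition iter_partial s F : 'cV[R]_d -> R := foldr partial F s.

Definition grad F z : 'rV[R]_d := \row_i partial i F z.

Definition C1 F := (forall z, differentiable F z) /\ continuous (grad F).

(* k times continuously partially differentiable on O. O is meant to be open: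
   derivatives and continuity are those of F on the whole space. *)
Definition Ck_on (k : nat) (O : set 'cV[R]_d) F :=
  (forall s (i : 'I_d) z, (size s < k)%N -> O z ->
     derivable (iter_partial s F) z (delta_mx i 0)) /\
  (forall s z, (size s <= k)%N -> O z ->
     {for z, continuous (iter_partial s F)}).

(* The derivative of F of multi-order a = (a_0, a_1, ...): the index i is
   repeated a_i times. *)
Definition multi_partial (N : nat) (a : {ffun 'I_d -> 'I_N.+1}) F :=
  iter_partial (flatten [seq nseq (a i) i | i <- enum 'I_d]) F.

(* The sum over |a| <= N of (d^a F(z0) / a!) v^a, in the increment v. The
   components of such an a are at most N, whence the type of a. *)
Definition taylor_poly (N : nat) F z0 (v : 'cV[R]_d) : R :=
  \sum_(a : {ffun 'I_d -> 'I_N.+1} | (\sum_i a i <= N)%N)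
    multi_partial a F z0 / (\prod_i (a i)`!)%N%:R * \prod_i v i 0 ^+ a i.

(* P is the polynomial in the increment z - z0. *)
Definition interval_taylor_model (N : nat) F (S : set 'cV[R]_d) z0
    (P : 'cV[R]_d -> R) (I : set R) :=
  [/\ S z0,
      exists O, [/\ open O, S `<=` O & Ck_on N.+1 O F],
      P = taylor_poly N F z0,
      is_interval I &
      forall z, S z -> exists2 r, I r & F z = P (z - z0) + r].

End Smoothness.

Definition is_minimum (R : realType) (T : Type) (A : set T) (F : T -> R)
    (m : R) :=
  (exists2 z, A z & F z = m) /\ (forall z, A z -> m <= F z).

Definition locally_lipschitz (R : realType) (V W : normedModType R)
    (F : V -> W) :=
  forall x : V, exists2 A, nbhs x A & [lipschitz F y | y in A].

Section ControlSystem.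
Context {R : realType} {n m : nat}.
Variables (f : 'cV[R]_n -> 'cV[R]_n) (g : 'cV[R]_n -> 'M[R]_(n, m)).
Variable U : set 'cV[R]_m.

Definition lie_f (h : 'cV[R]_n -> R) (x : 'cV[R]_n) : R :=
  (grad h x *m f x) 0 0.

Definition lie_g (h : 'cV[R]_n -> R) (x : 'cV[R]_n) : 'rV[R]_m :=
  grad h x *m g x.

(* Relative degree r on the whole of R^n, for a scalar output h; with a vector
   input, L_g L_f^(r-1) h(x) is a row, required to be non-zero. *)
Definition has_relative_degree (h : 'cV[R]_n -> R) (r : nat) :=
  [/\ (0 < r)%N,
      forall i x, (i < r.-1)%N -> lie_g (iter i lie_f h) x = 0 &
      forall x, lie_g (iter r.-1 lie_f h) x != 0].

(* Only the restriction of u to [t0, +oo[ matters. Local boundedness is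
   pointwise; a locally essentially bounded U-valued signal has such a
   representative. *)
Definition input_signal (t0 : R) (u : R -> 'cV[R]_m) :=
  [/\ forall t, t0 <= t -> U (u t),
      forall i, measurable_fun `[t0, +oo[ (fun t => u t i 0) &
      forall t1, [bounded u t | t in `[t0, t1]]].

(* Caratheodory solution of x' = f(x) + g(x) u on [t0, +oo[, in integral form
   and componentwise. Integrability is explicit because the integral of a
   non-integrable function has a junk value. *)
Definition is_solution (t0 : R) (x0 : 'cV[R]_n) (u : R -> 'cV[R]_m)
    (x : R -> 'cV[R]_n) :=
  [/\ x t0 = x0,
      {within `[t0, +oo[, continuous x} &
      forall (t : R) (i : 'I_n), t0 <= t ->
        let v := fun s => (f (x s) + g (x s) *m u s) i 0 in
        lebesgue_measure.-integrable `[t0, t] (EFin \o v) /\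
        x t i 0 = x0 i 0 + \int[lebesgue_measure]_(s in `[t0, t]) v s].

Definition solutions_exist :=
  forall t0 x0 u, input_signal t0 u -> exists x, is_solution t0 x0 u x.

Definition reach_tube (t0 t1 : R) (x0 : 'cV[R]_n) : set 'cV[R]_n :=
  [set y | exists u x t, [/\ input_signal t0 u, is_solution t0 x0 u x,
                             t0 <= t <= t1 & y = x t]].

(* The product of the reachable tube with U, a pair (x, u) being the column
   col_mx x u of R^(n+m). *)
Definition tube_input (t0 t1 : R) (x0 : 'cV[R]_n) : set 'cV[R]_(n + m) :=
  [set z | reach_tube t0 t1 x0 (usubmx z) /\ U (dsubmx z)].

Variables (h : 'cV[R]_n -> R) (gamma : R).

Definition xi (x : 'cV[R]_n) (u : 'cV[R]_m) : R :=
  lie_f h x + (lie_g h x *m u) 0 0 + gamma * h x.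

Definition delta_xi (xk : 'cV[R]_n) (z : 'cV[R]_(n + m)) : R :=
  xi (usubmx z) (dsubmx z) - xi xk (dsubmx z).

Definition K_zcbf (phi : 'cV[R]_n -> R -> R) (xk : 'cV[R]_n) (Delta : R) :
    set 'cV[R]_m :=
  [set u | U u /\
     0 <= lie_f h xk + (lie_g h xk *m u) 0 0 + gamma * h xk + phi xk Delta].

End ControlSystem.

(* Main.v *)
(* The sampled-data input is itself an admissible input signal from each t_k on,
   so x(s) lies in the reachable tube for t_k <= s <= t_(k+1). There the Taylor
   model gives xi(x(s), u_k) >= xi(x_k, u_k) + phi(x_k, Delta_k) >= 0, which says
   that y = h o x satisfies y' + gamma y >= 0 between sampling instants; hence
   y(s) >= exp(- gamma (s - t_k)) y(t_k), and one concludes by induction on k. *)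

Require Import Defs.

Local Open Scope classical_set_scope.
Local Open Scope ring_scope.

(** * Calculus along curves *)

Lemma locally_lipschitz_continuous (R : realType) (V W : normedModType R)
  (F : V -> W) : locally_lipschitz F -> continuous F.
Proof.
move=> lipF x; have [A xA [M [Mreal lipM]]] := lipF x.
have Ax : A x := nbhs_singleton xA.
(* The Lipschitz bound holds for every constant strictly above [M]; taking the maximum with 1 also
   makes [K] positive, so that [e / K] is a legitimate radius. *)
set K := Num.max (M + 1) 1.
have K0 : 0 < K by rewrite lt_max ltr01 orbT.
have FK y : A y -> `|F x - F y| <= K * `|x - y|.
  by move=> Ay; apply: (lipM K _ (x, y)) => //; rewrite lt_max ltrDl ltr01.
apply/cvgrPdist_le => e e0; near=> y.
rewrite (le_trans (FK y _))//; first by near: y.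
rewrite mulrC -ler_pdivlMr//; near: y.
exact: (cvgrPdist_le _ _).1 (@cvg_id _ _) _ (divr_gt0 e0 K0).
Unshelve. all: by end_near. Qed.

Lemma grad_mulmxE (R : realType) (d : nat) (F : 'cV[R]_d -> R) z v :
  differentiable F z -> (grad F z *m v) 0 0 = 'd F z v.
Proof.
move=> dF; rewrite [in RHS](matrix_sum_delta v) linear_sum !mxE.
apply: eq_bigr => i _; rewrite big_ord1 linearZ/= mxE /partial deriveE//.
by rewrite mulrC.
Qed.

(** The chain rule for a curve whose derivative is known coordinate by coordinate, which is how the
    integral equation supplies it. *)
Lemma is_derive_comp_col (R : realType) (d : nat) (F : 'cV[R]_d -> R)
    (x : R -> 'cV[R]_d) (s : R) (v : 'cV[R]_d) :
  (forall i, is_derive s 1 (fun r => x r i 0) (v i 0)) ->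
  differentiable F (x s) ->
  is_derive s 1 (F \o x) ((grad F (x s) *m v) 0 0).
Proof.
move=> dx dF.
have derx : derivable x s 1.
  by apply/derivable_mxP => i j; rewrite ord1; exact: ex_derive.
have dfx : differentiable x s by exact/derivable1_diffP.
apply: DeriveDef; first exact/derivable1_diffP/differentiable_comp.
rewrite deriveE; last exact: differentiable_comp.
rewrite diff_comp//= -(deriveE _ dfx) derive_mx// -grad_mulmxE//.
congr ((_ *m _) _ _); apply/matrixP => i j; rewrite mxE ord1.
exact: derive_val.
Qed.

Lemma derive_ge0_comparison (R : realType) (y dy : R -> R) (a b gamma : R) :
  {within `[a, b], continuous y} ->
  (forall s, a < s < b -> is_derive s 1 y (dy s)) ->
  (forall s, a < s < b -> 0 <= dy s + gamma * y s) ->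
  0 <= y a -> forall s, a <= s <= b -> 0 <= y s.
Proof.
(* The function [expR (gamma * r) * y r] is nondecreasing. *)
move=> yc dyE dy0 ya0 s /andP[as_ sb].
pose e r := expR (gamma * r).
have ab : a <= b by exact: le_trans sb.
have de (r : R) : is_derive r 1 e (gamma * e r).
  by apply: is_derive_eq; rewrite /GRing.scale/= mulr1 mulrC.
have dz (r : R) : a < r < b -> is_derive r 1 (e * y) (e r *: dy r + y r *: (gamma * e r)).
  by move=> rab; have := dyE r rab; have := de r => ? ?; exact: is_deriveM.
have zc : {within `[a, b], continuous (e * y)}.
  move=> r; apply: continuousM; last exact: yc.
  apply: continuous_subspaceT => q.
  exact/differentiable_continuous/derivable1_diffP/(@ex_derive _ _ _ _ _ _ _ (de q)).
have : (e * y) a <= (e * y) s.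
  apply: (@ger0_derive1_le_cc _ (e * y) a b) => //.
  - by move=> r; rewrite in_itv/= => /dz[].
  - move=> r; rewrite in_itv/= => rab; rewrite derive1E.
    rewrite (@derive_val _ _ _ _ _ _ _ (dz r rab)) /GRing.scale/=.
    have -> : e r * dy r + y r * (gamma * e r) = e r * (dy r + gamma * y r).
      by rewrite mulrDr [y r * _]mulrC [gamma * _]mulrC mulrA.
    by rewrite mulr_ge0 ?expR_ge0 ?dy0.
  - by rewrite in_itv/= lexx.
  - by rewrite in_itv/= as_.
rewrite !fctE => /(le_trans (mulr_ge0 (expR_ge0 _) ya0)).
by rewrite pmulr_rge0 ?expR_gt0.
Qed.

(** * Restarting and differentiating solutions *)

(** Additivity of the integral at [a]. It lets the trajectory be restarted at each sampling instant,
    as the reachable tube requires. *)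
Lemma is_solution_shift (R : realType) (n m : nat)
    (f : 'cV[R]_n -> 'cV[R]_n) (g : 'cV[R]_n -> 'M[R]_(n, m))
    (t0 a : R) x0 u x :
  is_solution f g t0 x0 u x -> t0 <= a -> is_solution f g a (x a) u x.
Proof.
move=> [xt0 xc xE] t0a; split => //.
  by apply: continuous_subspaceW xc; apply: subset_itvr; rewrite bnd_simp.
move=> t i at_ v.
have [iv xt] := xE t i (le_trans t0a at_).
have [_ xa] := xE a i t0a.
split.
  apply: integrableS iv => //.
  by apply: subset_itvr; rewrite bnd_simp.
rewrite xt xa -addrA; congr (_ + _); apply/eqP; rewrite addrC -subr_eq; apply/eqP.
rewrite Rintegral_itvB//; try by rewrite bnd_simp.
(* The difference of the integrals is over the half-open interval from [a] to [t]; adding the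
   endpoint [a] changes nothing. *)
rewrite Rintegral_itv_obnd_cbnd//.
apply: integrableS iv => //.
by apply: subset_itvScc; rewrite ?bnd_simp.
Qed.

(* The Lebesgue integral equation can be differentiated at every time around
   which the input is constant, since the integrand is continuous there. *)
Lemma is_solution_derive (R : realType) (n m : nat)
    (f : 'cV[R]_n -> 'cV[R]_n) (g : 'cV[R]_n -> 'M[R]_(n, m))
    (t0 s : R) x0 u w x :
  continuous f -> continuous g -> is_solution f g t0 x0 u x -> t0 < s ->
  (\forall r \near s, u r = w) ->
  forall i, is_derive s 1 (fun r => x r i 0) ((f (x s) + g (x s) *m w) i 0).
Proof.
move=> fc gc [xt0 xc xE] t0s us i.
have usE : u s = w := nbhs_singleton us.
pose v r := (f (x r) + g (x r) *m u r) i 0.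
have xs : {for s, continuous x}.
  apply: (@within_continuous_continuous _ _ _ t0 (s + 1)).
  - by rewrite (lt_trans t0s)// ltrDl.
  - by apply: continuous_subspaceW xc; apply: subset_itvl.
  - by rewrite in_itv/= t0s ltrDl ltr01.
have vs : {for s, continuous v}.
  (* Near [s] the input is frozen at [w], so only the continuity of [f], [g] and [x] matters. *)
  have vE : \forall r \near s,
      f (x r) i 0 + \sum_j g (x r) i j * w j 0 = v r.
    by near=> r; rewrite /v (near us r)// !mxE.
  rewrite /continuous_at; apply: (cvg_trans (near_eq_cvg vE)).
  rewrite /v usE !mxE.
  apply: cvgD.
    apply: (@cvg_comp _ _ _ (f \o x) (fun M : 'cV[R]_n => M i 0)).
      exact: (continuous_comp xs (fc _)).
    exact: coord_continuous.
  apply: cvg_big => [|j _]; first exact: add_continuous.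
  apply: cvgM; last exact: cvg_cst.
  apply: (@cvg_comp _ _ _ (g \o x) (fun M : 'M[R]_(n, m) => M i j)).
    exact: (continuous_comp xs (gc _)).
  exact: coord_continuous.
(* Any time beyond [s] would do: [s] has to be interior to the interval of integration. *)
have ss1 : s < s + 1 by rewrite ltrDl.
have [iv _] := xE (s + 1) i (ltW (lt_trans t0s ss1)).
have [] := continuous_FTC1_closed ss1 iv t0s vs.
set G := (fun _ => _) => dG G'.
have xG : \forall r \near s, x0 i 0 + G r = x r i 0.
  near=> r; have [|_ ->//] := xE r i.
  by apply/ltW; near: r; exact: lt_nbhsr.
have dxG : is_derive s 1 (fun r => x0 i 0 + G r) (v s).
  apply: is_derive_eq; last exact: add0r.
  by apply: is_deriveD; apply: DeriveDef => //; rewrite -derive1E.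
by rewrite -usE; apply: near_eq_is_derive xG dxG.
Unshelve. all: by end_near. Qed.

(** * Sampled-data inputs *)

(** The least index whose instant exceeds [s] is not 0, and its predecessor is the required [k]. *)
Lemma sampling_interval (R : realType) (t : nat -> R) (s : R) :
  t k @[k --> \oo] --> +oo -> t 0%N <= s -> exists k, t k <= s < t k.+1.
Proof.
move=> /cvgryPgt/(_ s)[K _ sK] t0s.
have [|[|k] sk min_k] := ex_minnP (P := fun k => s < t k).
- by exists K; apply: sK => /=.
- by move: sk; rewrite ltNge t0s.
- exists k; rewrite sk andbT leNgt; apply/negP => /min_k.
  by rewrite ltnn.
Qed.

(** The signal is constant on each of countably many intervals, hence measurable; only finitely many
    of them meet a bounded interval, hence it is locally bounded. *)
Lemma sampled_input_signal (R : realType) (m : nat) (U : set 'cV[R]_m)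
    (t : nat -> R) (u : R -> 'cV[R]_m) (u_ : nat -> 'cV[R]_m) :
  (forall k, t k < t k.+1) -> t k @[k --> \oo] --> +oo ->
  (forall k, U (u_ k)) -> (forall k s, t k <= s < t k.+1 -> u s = u_ k) ->
  input_signal U (t 0%N) u.
Proof.
move=> t_incr t_infty Uu uE.
have t_mono : {homo t : i j / (i <= j)%N >-> i <= j}.
  by apply/nondecreasing_seqP => k; exact/ltW.
split.
- by move=> s /(sampling_interval _ _ _ t_infty)[k /uE ->].
- move=> i.
  have -> : `[t 0%N, +oo[%classic = \bigcup_k `[t k, t k.+1[%classic.
    apply/seteqP; split => r /=.
      rewrite in_itv/= andbT => /(sampling_interval _ _ _ t_infty)[k tk].
      by exists k.
    move=> [k _ /=]; rewrite !in_itv/= andbT => /andP[+ _].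
    exact/le_trans/t_mono.
  apply/measurable_fun_bigcup => // k.
  apply: (@eq_measurable_fun _ _ _ _ _ (fun=> u_ k i 0)) => //.
  by move=> r; rewrite inE/= in_itv/= => /uE ->.
- move=> t1; move/cvgryPgt : (t_infty) => /(_ t1)[J _ t1J].
  (* All instants from index [J] on exceed [t1], so only the values [u_ j] with [j < J] occur; the
     sum of their norms dominates each of them. *)
  exists (\sum_(j < J) `|u_ j|); split; first exact: num_real.
  move=> M uM r /=; rewrite in_itv/= => /andP[t0r rt1].
  have [k tk] := sampling_interval _ _ _ t_infty t0r.
  have kJ : (k < J)%N.
    rewrite ltnNge; apply/negP => /t_mono Jk.
    case/andP: tk => tkr _.
    have := le_lt_trans (le_trans Jk (le_trans tkr rt1)) (t1J J (leqnn J)).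
    by rewrite ltxx.
  rewrite (uE _ _ tk) (le_trans _ (ltW uM))// (bigD1 (Ordinal kJ))//=.
  by rewrite lerDl sumr_ge0.
Qed.

Lemma input_signal_shift (R : realType) (m : nat) (U : set 'cV[R]_m)
    (t0 a : R) (u : R -> 'cV[R]_m) :
  input_signal U t0 u -> t0 <= a -> input_signal U a u.
Proof.
move=> [Uu mu bu] t0a; split.
- by move=> t /(le_trans t0a); exact: Uu.
- move=> i; apply: measurable_funS (mu i) => //.
  by apply: subset_itvr; rewrite bnd_simp.
- move=> t1; apply: sub_boundedr (bu t1).
  move=> A At r ra; apply: At; move: r ra.
  by apply: subset_itvr; rewrite bnd_simp.
Qed.

(** * Invariance across sampling intervals *)

(** With the same input [w] at both states, [xi] changes from [xk] to [x] by a polynomial value, at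
    least [phistar], plus a remainder in [I], at least [inf I]. Their sum is at least [phi], the
    margin built into [K_zcbf]. *)
Lemma xi_ge0_on_tube (R : realType) (n m : nat)
    (f : 'cV[R]_n -> 'cV[R]_n) (g : 'cV[R]_n -> 'M[R]_(n, m))
    (U : set 'cV[R]_m) (h : 'cV[R]_n -> R) (gamma : R) (N : nat)
    (a b : R) (xk x : 'cV[R]_n) (w : 'cV[R]_m) (zstar : 'cV[R]_(n + m))
    (P : 'cV[R]_(n + m) -> R) (I : set R) (phistar : R)
    (phi : 'cV[R]_n -> R -> R) (Delta : R) :
  interval_taylor_model N (delta_xi f g h gamma xk)
    (tube_input f g U a b xk) zstar P I ->
  has_lbound I ->
  is_minimum (tube_input f g U a b xk) (fun z => P (z - zstar)) phistar ->
  phi xk Delta = inf I + phistar ->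
  K_zcbf f g U h gamma phi xk Delta w ->
  reach_tube f g U a b xk x ->
  0 <= xi f g h gamma x w.
Proof.
move=> [_ _ _ _ PI] I_lb [_ P_min] phiE [Uw Kw] Rx.
have Zz : tube_input f g U a b xk (col_mx x w).
  by split; rewrite ?col_mxKu ?col_mxKd.
have [r Ir] := PI _ Zz.
rewrite /delta_xi col_mxKu col_mxKd => /eqP; rewrite subr_eq => /eqP ->.
rewrite (le_trans Kw)// addrC phiE -/(xi f g h gamma xk w) lerD2r addrC.
(* [inf] has a default value on sets unbounded below; [I_lb] ensures that it is a true lower bound
   here. *)
by rewrite lerD ?P_min// ge_inf.
Qed.

Theorem proposition1 (R : realType) (n m : nat)
  (f : 'cV[R]_n -> 'cV[R]_n) (g : 'cV[R]_n -> 'M[R]_(n, m))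
  (U : set 'cV[R]_m) (h : 'cV[R]_n -> R) (gamma : R)
  (lip_f : locally_lipschitz f) (lip_g : locally_lipschitz g)
  (complete_fg : solutions_exist f g U)
  (C1_h : C1 h) (reldeg_h : has_relative_degree f g h 1)
  (gamma_gt0 : 0 < gamma)
  (t : nat -> R) (t0 : t 0%N = 0) (t_incr : forall k, t k < t k.+1)
  (t_infty : t k @[k --> \oo] --> +oo)
  (x : R -> 'cV[R]_n) (u : R -> 'cV[R]_m) (u_ : nat -> 'cV[R]_m)
  (N : nat) (zstar : nat -> 'cV[R]_(n + m))
  (P : nat -> 'cV[R]_(n + m) -> R) (I : nat -> set R)
  (taylor : forall k,
     interval_taylor_model N (delta_xi f g h gamma (x (t k)))
       (tube_input f g U (t k) (t k.+1) (x (t k))) (zstar k) (P k) (I k))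
  (I_lb : forall k, has_lbound (I k))
  (phistar : nat -> R)
  (phistar_min : forall k,
     is_minimum (tube_input f g U (t k) (t k.+1) (x (t k)))
       (fun z => P k (z - zstar k)) (phistar k))
  (phi : 'cV[R]_n -> R -> R)
  (phiE : forall k, phi (x (t k)) (t k.+1 - t k) = inf (I k) + phistar k)
  (K_neq0 : forall k,
     K_zcbf f g U h gamma phi (x (t k)) (t k.+1 - t k) !=set0)
  (hx0 : 0 <= h (x 0))
  (u_K : forall k, K_zcbf f g U h gamma phi (x (t k)) (t k.+1 - t k) (u_ k))
  (u_hold : forall k s, t k <= s < t k.+1 -> u s = u_ k)
  (sol_x : is_solution f g 0 (x 0) u x) :
  forall s, 0 <= s -> 0 <= h (x s).
Proof.
(* [xi] is the derivative of [h] along the vector field with input [w], plus [gamma * h]. *)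
have lie_xi y w : xi f g h gamma y w
    = (grad h y *m (f y + g y *m w)) 0 0 + gamma * h y.
  by rewrite /xi /lie_f /lie_g mulmxDr mulmxA [in RHS]mxE.
have t_ge0 k : 0 <= t k.
  by elim: k => [|k IHk]; [rewrite t0|exact: le_trans (ltW (t_incr k))].
have sol_k k : is_solution f g (t k) (x (t k)) u x.
  exact: is_solution_shift sol_x (t_ge0 k).
have sig_k k : input_signal U (t k) u.
  apply: input_signal_shift (t_ge0 k); rewrite -t0.
  by apply: sampled_input_signal u_hold => // j; have [] := u_K j.
have tube_k k r : t k <= r <= t k.+1 ->
    reach_tube f g U (t k) (t k.+1) (x (t k)) (x r).
  by move=> rk; exists u, x, r.
(* The interval is closed on the right, so the sign reaches [t k.+1] and starts the next step. *)
have step k : 0 <= h (x (t k)) ->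
    forall r, t k <= r <= t k.+1 -> 0 <= h (x r).
  move=> hk.
  apply: (@derive_ge0_comparison R (h \o x)
    (fun r => (grad h (x r) *m (f (x r) + g (x r) *m u_ k)) 0 0)
    _ _ gamma) => //.
  - have [_ xc _] := sol_k k.
    have xck : {within `[t k, t k.+1], continuous x}.
      by apply: continuous_subspaceW xc; exact: subset_itvl.
    move=> r.
    apply: (@continuous_comp (subspace `[t k, t k.+1]) _ _ x h r (xck r)).
    exact/differentiable_continuous/(proj1 C1_h).
  (* The input may jump at the sampling instants; strictly between them it is constant around [r],
     and [x] can be differentiated. *)
  - move=> r /andP[kr rk]; apply: is_derive_comp_col; last exact: (proj1 C1_h).
    have fc := locally_lipschitz_continuous _ _ _ _ lip_f.
    have gc := locally_lipschitz_continuous _ _ _ _ lip_g.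
    apply: (is_solution_derive _ _ _ _ _ _ _ _ _ _ _ fc gc (sol_k k) kr).
    near=> q; apply: u_hold; apply/andP; split.
      by apply/ltW; near: q; exact: lt_nbhsr.
    by near: q; exact: lt_nbhsl.
  - move=> r /andP[kr rk]; rewrite /= -lie_xi.
    apply: xi_ge0_on_tube (taylor k) (I_lb k) (phistar_min k) (phiE k) (u_K k) _.
    by apply: tube_k; rewrite !ltW.
have ht k : 0 <= h (x (t k)).
  elim: k => [|k /step]; first by rewrite t0.
  by apply; rewrite lexx ltW.
move=> s s0; have [|k /andP[ks sk]] := sampling_interval _ t s t_infty.
  by rewrite t0.
by apply: (step k) => //; rewrite ks ltW.
Unshelve. all: by end_near. Qed.
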